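(* The group $H(2^{\mathbb{N}})$ of all homeomorphisms of the Cantor set $2^{\mathbb{N}}$ has ample generics; that is, for every integer $m\ge 1$ the diagonal conjugacy action of $H(2^{\mathbb{N}})$ on $H(2^{\mathbb{N}})^m$, $$g\cdot(h_1,h_2,\ldots,h_m)=(gh_1g^{-1},gh_2g^{-1},\ldots,gh_mg^{-1}),$$ has a comeager orbit.
   Context: $H(2^{\mathbb{N}})$ is the group of homeomorphisms of the Cantor set, with its usual Polish group topology, namely the topology of uniform convergence with respect to any compatible metric on $2^{\mathbb{N}}$. The power $H(2^{\mathbb{N}})^m$ carries the product topology. A subset is comeager if it contains a countable intersection of dense open sets. *)

(* Defs.v *)
From HB Require Import structures.
From mathcomp Require Import all_boot all_classical.
From mathcomp Require Import topology cantor borel_hierarchy.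

Set Implicit Arguments.
Unset Strict Implicit.
Unset Printing Implicit Defensive.

Local Open Scope classical_set_scope.
Local Open Scope group_scope.

HB.mixin Record Group_isTopological G of Topological G & monoid.Group G := {
  mulg_continuous : continuous (fun xy : G * G => xy.1 * xy.2) ;
  invg_continuous : continuous (fun x : G => x^-1)
}.

#[short(type="topGroupType")]
HB.structure Definition TopologicalGroup :=
  {G of Group_isTopological G & Topological G & monoid.Group G}.

Definition comeager (T : topologicalType) (A : set T) : Prop :=
  exists2 S : set T, Gdelta_dense S & S `<=` A.

Section ample_generics.
Variable G : topGroupType.

Definition power (m : nat) : topologicalType :=
  prod_topology (fun _ : 'I_m => G).

Definition diag_conj (m : nat) (g : G) (h : power m) : power m :=
  fun i => g * h i * g^-1.

Definition diag_conj_orbit (m : nat) (h : power m) : set (power m) :=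
  [set diag_conj g h | g in [set: G]].

Definition ample_generics : Prop :=
  forall m : nat, (1 <= m)%N ->
    exists h : power m, comeager (diag_conj_orbit h).

End ample_generics.

Definition homeomorphism (T U : topologicalType) (f : T -> U) : Prop :=
  exists g : U -> T, [/\ continuous f, continuous g, cancel f g & cancel g f].

Local Notation C := cantor_space.

(* Cantor space is compact Hausdorff, so its uniformity is the one of every
   compatible metric; the subspace topology inherited from [{uniform C -> C}]
   is that of uniform convergence for any of them. *)
Definition cantor_homeo : Type :=
  set_type [set f : {uniform C -> C} | homeomorphism (f : C -> C)].

HB.instance Definition _ := Topological.on cantor_homeo.

Definition homeo_fun (f : cantor_homeo) : C -> C := set_val f.

Section group.
Implicit Types f g h : cantor_homeo.

Lemma homeo_funP f : homeomorphism (homeo_fun f).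
Proof. exact: (set_valP f). Qed.

Lemma homeo_ext f g : homeo_fun f =1 homeo_fun g -> f = g.
Proof. by move=> fg; apply/val_inj/funext. Qed.

Definition mk_homeo (f : C -> C) (hf : homeomorphism f) : cantor_homeo :=
  SigSub (mem_set hf : (f : {uniform C -> C}) \in
    [set f : {uniform C -> C} | homeomorphism (f : C -> C)]).

Definition homeo_inv_fun f : C -> C := projT1 (cid (homeo_funP f)).

Lemma homeo_inv_funP f : [/\ continuous (homeo_fun f),
  continuous (homeo_inv_fun f), cancel (homeo_fun f) (homeo_inv_fun f)
  & cancel (homeo_inv_fun f) (homeo_fun f)].
Proof. exact: (projT2 (cid (homeo_funP f))). Qed.

Lemma homeo_one_subproof : homeomorphism (idfun : C -> C).
Proof. by exists idfun; split=> // x; exact: cvg_id. Qed.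

Lemma homeo_mul_subproof f g : homeomorphism (homeo_fun f \o homeo_fun g).
Proof.
have [cf cf' fK f'K] := homeo_inv_funP f.
have [cg cg' gK g'K] := homeo_inv_funP g.
exists (homeo_inv_fun g \o homeo_inv_fun f); split.
- by move=> x; apply: continuous_comp; [exact: cg|exact: cf].
- by move=> x; apply: continuous_comp; [exact: cf'|exact: cg'].
- exact: can_comp.
- exact: can_comp.
Qed.

Lemma homeo_inv_subproof f : homeomorphism (homeo_inv_fun f).
Proof. by have [] := homeo_inv_funP f; exists (homeo_fun f). Qed.

Definition homeo_one : cantor_homeo := mk_homeo homeo_one_subproof.
Definition homeo_mul f g : cantor_homeo := mk_homeo (homeo_mul_subproof f g).
Definition homeo_inv f : cantor_homeo := mk_homeo (homeo_inv_subproof f).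

Lemma homeo_mulA : associative homeo_mul.
Proof. by move=> f g h; apply: homeo_ext. Qed.

Lemma homeo_mul1 : left_id homeo_one homeo_mul.
Proof. by move=> f; apply: homeo_ext. Qed.

Lemma homeo_mulr1 : right_id homeo_one homeo_mul.
Proof. by move=> f; apply: homeo_ext. Qed.

Lemma homeo_mulV : left_inverse homeo_one homeo_inv homeo_mul.
Proof.
by move=> f; apply: homeo_ext => x; have [_ _ fK _] := homeo_inv_funP f; exact: fK.
Qed.

Lemma homeo_mulrV : right_inverse homeo_one homeo_inv homeo_mul.
Proof.
by move=> f; apply: homeo_ext => x; have [_ _ _ fK] := homeo_inv_funP f; exact: fK.
Qed.

End group.

HB.instance Definition _ := monoid.isGroup.Build cantor_homeo
  homeo_mulA homeo_mul1 homeo_mulr1 homeo_mulV homeo_mulrV.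

Lemma homeo_mulE (f g : cantor_homeo) (x : C) :
  homeo_fun (f * g) x = homeo_fun f (homeo_fun g x).
Proof. by []. Qed.

Section topology.
Implicit Types f g h : cantor_homeo.

Lemma homeo_fun_continuous f : continuous (homeo_fun f).
Proof. by have [] := homeo_inv_funP f. Qed.

Lemma homeo_nbhsP f (P : set cantor_homeo) :
  nbhs f P <-> exists2 E, entourage E &
    [set h | forall x, E (homeo_fun f x, homeo_fun h x)] `<=` P.
Proof.
split.
  move=> [_ [[/= W oW <-] Wf WP]].
  have /uniform_nbhs[E [entE EW]] : nbhs (set_val f : {uniform C -> C}) W.
    exact: open_nbhs_nbhs.
  by exists E => // h Eh; apply/WP/EW => y _; exact: Eh.
move=> [E entE EP].
have nE : nbhs (set_val f : {uniform C -> C})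
    [set h | forall y, [set: C] y -> E (set_val f y, h y)].
  by apply/uniform_nbhs; exists E; split.
have := @initial_continuous cantor_homeo {uniform C -> C} set_val f _ nE.
by apply: (@filterS cantor_homeo (nbhs f)) => h Eh; apply: EP => x; exact: Eh.
Qed.

Lemma continuous_pair (T U V : topologicalType) (f : T -> U) (g : T -> V) :
  continuous f -> continuous g -> continuous (fun x => (f x, g x)).
Proof.
move=> cf cg x P [[A B] [/= /cf Af /cg Bg] AB].
apply: (@filterS2 _ (nbhs x) _ _ _ _ _ Af Bg) => y fy gy.
exact: (AB (f y, g y)).
Qed.

Lemma near_entourage (T : topologicalType) (a : T -> C) (t : T) E :
  entourage E -> {for t, continuous a} -> \forall s \near t, E (a t, a s).
Proof. by move=> entE /cvg_app_entourageP; exact. Qed.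

Lemma homeo_eval_continuous :
  continuous (fun p : cantor_homeo * C => homeo_fun p.1 p.2).
Proof.
move=> [f x]; apply/cvg_app_entourageP => /= E entE.
have nf : \forall h \near f, forall y,
    split_ent E (homeo_fun f y, homeo_fun h y).
  apply/homeo_nbhsP; exists (split_ent E); last exact: subset_refl.
  exact: entourage_split_ent.
near=> p.
apply: (entourage_split (homeo_fun f p.2)) => //.
  near: p; apply: (@near_entourage _ (homeo_fun f \o snd) (f, x)).
    exact: entourage_split_ent.
  by apply: continuous_comp; [exact: cvg_snd|exact: homeo_fun_continuous].
near: p; have [[P Q] PQ sub] := @cvg_fst _ _ (nbhs f) (nbhs x) _ _ nf.
by exists (P, Q) => // p /sub; apply.
Unshelve. all: by end_near. Qed.

Lemma near_uniform (T : topologicalType) (t : T) (a b : T * C -> C) E :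
  entourage E -> continuous a -> continuous b ->
  (forall x, a (t, x) = b (t, x)) ->
  \forall s \near t, forall x, E (a (s, x), b (s, x)).
Proof.
move=> entE ca cb ab; have /compact_near_coveringP cov := cantor_space_compact.
suff : \forall s \near t, [set: C] `<=` (fun x => E (a (s, x), b (s, x))).
  by apply: filterS => s sE x; exact: sE.
apply: cov => x _.
suff : \forall p \near (t, x), E (a p, b p).
  move=> [[P Q] /= [Pt Qx] PQ]; exists (Q, P) => //= -[y s] [/= Qy Ps].
  exact: (PQ (s, y)).
near=> p; apply: (entourage_split (a (t, x))) => //.
  near: p; apply: (@near_entourage _ a (t, x) (split_ent E)^-1%relation).
    exact: entourage_inv (entourage_split_ent entE).
  exact: ca.
rewrite ab; near: p; apply: (near_entourage _ (cb (t, x))).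
exact: entourage_split_ent.
Unshelve. all: by end_near. Qed.

Lemma homeo_mulg_continuous :
  continuous (fun fg : cantor_homeo * cantor_homeo => fg.1 * fg.2).
Proof.
move=> [f g] P /homeo_nbhsP[E entE EP].
pose a (p : cantor_homeo * cantor_homeo * C) := homeo_fun (f * g) p.2.
pose b (p : cantor_homeo * cantor_homeo * C) :=
  homeo_fun p.1.1 (homeo_fun p.1.2 p.2).
have ca : continuous a.
  move=> p; apply: (@continuous_comp _ _ _ snd (homeo_fun (f * g))).
    exact: cvg_snd.
  exact: homeo_fun_continuous.
have cb : continuous b.
  move=> p; apply: (@continuous_comp _ _ _ (fun p => (p.1.1, homeo_fun p.1.2 p.2))
    (fun p => homeo_fun p.1 p.2)); last exact: homeo_eval_continuous.
  apply: continuous_pair => {}p.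
    by apply: (@continuous_comp _ _ _ fst fst); exact: cvg_fst.
  apply: (@continuous_comp _ _ _ (fun p => (p.1.2, p.2))
    (fun p => homeo_fun p.1 p.2)); last exact: homeo_eval_continuous.
  apply: continuous_pair => {}p; last exact: cvg_snd.
  by apply: (@continuous_comp _ _ _ fst snd); [exact: cvg_fst|exact: cvg_snd].
have ab x : a (f, g, x) = b (f, g, x) by [].
by apply: filterS (near_uniform entE ca cb ab) => fg fgE; exact: EP.
Qed.

Lemma homeo_invg_continuous : continuous (fun f : cantor_homeo => f^-1).
Proof.
move=> f P /homeo_nbhsP[E entE EP].
pose a (p : cantor_homeo * C) := homeo_fun f^-1 (homeo_fun p.1 p.2).
have ca : continuous a.
  move=> p; apply: (@continuous_comp _ _ _ (fun p => homeo_fun p.1 p.2)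
    (homeo_fun f^-1)).
    exact: homeo_eval_continuous.
  exact: homeo_fun_continuous.
have cb : continuous (snd : cantor_homeo * C -> C) by move=> p; exact: cvg_snd.
have [_ _ fK _] := homeo_inv_funP f.
have := near_uniform entE ca cb fK.
apply: filterS => g gE; apply: EP => x.
have [_ _ _ gK] := homeo_inv_funP g.
by have := gE (homeo_fun g^-1 x); rewrite /a /= gK.
Qed.

End topology.

HB.instance Definition _ := Group_isTopological.Build cantor_homeo
  homeo_mulg_continuous homeo_invg_continuous.

(* Main.v *)
Require Import Defs.
From mathcomp Require Import all_boot all_classical.
From mathcomp Require Import topology cantor borel_hierarchy.

(** A finite clopen partition of the Cantor set, presented as a locally
constant surjection [c] onto a finite set, turns a tuple [h] of homeomorphisms
into a finite graph with edges in [m] colors: [a] and [b] are joined by an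
[i]-edge when [h i] sends some point of color [a] to a point of color [b].
These patterns are serial (every vertex has a successor and a predecessor in
every color), refining a partition gives an epimorphism of graphs, and agreeing
with [h] on the pattern of a fine partition means being uniformly close to [h].
Conversely every serial graph mapping onto a given color set is the pattern of
some tuple ([coloring_split], [pattern_realize]), because any two locally
constant surjections onto a finite set are conjugate
([coloring_homogeneous]). So ample generics becomes an amalgamation
problem for finite serial graphs.

Amalgamation of two epimorphisms [B -> A] and [C -> A] can fail: a walk in [B]
and a walk in [C] may be unable to make the same choices in [A]. It succeeds
over the arboreal graphs, and every serial graph is covered by an arboreal one.
A vertex of an arboreal graph has at most one direction [up] in which its
neighbor is not determined. A way to picture them is by labelings of the Cayley
tree of the free group on [m] generators: root such a labeling at a vertex, make
one free choice there, and let every other vertex choose its neighbors, away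
from the root, by a fixed rule. The label of a vertex together with the
direction of the root then determines the labels on the whole branch
pointing away from the root ([arboreal_cover]). To lift a walk of [B] to [C]
over an arboreal [A], climb along [up] as far as desired, lift the highest
vertex arbitrarily, and descend: the descent is forced in [A], so the lift stays
over the given walk. By finiteness, arbitrarily long ascents of pairs give one
that is infinite or ends at a root, and the pairs at which such an ascent starts
form an amalgam ([arboreal_amalgam]).

Call a tuple generic when it has arboreal patterns on arbitrarily fine partitions
and when every epimorphism from a finite serial graph onto one of its arboreal
patterns is the pattern map of a refinement. Up to coding these are countably
many open conditions; covering by arboreal graphs and amalgamation over them
make each condition dense ([generic_Gdelta]). Two generic tuples are conjugate
by a back and forth that builds finer and finer pairs of partitions with equal
arboreal patterns ([generic_conjugate]), and a generic tuple exists by Baire category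
([baire]). Hence the orbit of any generic tuple contains the dense G-delta set of
all generic tuples. *)

Set Implicit Arguments.
Unset Strict Implicit.
Unset Printing Implicit Defensive.

Local Open Scope classical_set_scope.
Local Open Scope group_scope.

(** * Finite edge-colored graphs *)

Definition onto V W (f : V -> W) := forall w, exists v, f v = w.

Section graphs.
Variable I : finType.

Definition graph (V : Type) := I -> V -> V -> Prop.

(** A direction is a color together with an orientation: the directions are the
generators of the free group and their inverses. *)
Definition dir : finType := (I * bool)%type.
Implicit Type d : dir.

Definition opp d : dir := (d.1, ~~ d.2).

Lemma oppK : involutive opp.
Proof. by case=> i b; rewrite /opp /= negbK. Qed.

Definition nbr V (E : graph V) d x y := if d.2 then E d.1 x y else E d.1 y x.

Lemma nbr_opp V (E : graph V) d x y : nbr E (opp d) x y = nbr E d y x.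
Proof. by case: d => i []. Qed.

Definition serial V (E : graph V) := forall d x, exists y, nbr E d x y.

Definition epi V W (f : V -> W) (E : graph V) (E' : graph W) :=
  onto f /\
  (forall i w w', E' i w w' <-> exists v v', [/\ f v = w, f v' = w' & E i v v']).

Lemma epi_nbr V W (f : V -> W) E E' d x y :
  epi f E E' -> nbr E d x y -> nbr E' d (f x) (f y).
Proof. by case: d => i [] [_ fE] /= Exy; apply/fE; [exists x, y|exists y, x]. Qed.

Lemma epi_unique V W (f : V -> W) (E : graph V) (E1 E2 : graph W) :
  epi f E E1 -> epi f E E2 -> E1 = E2.
Proof.
move=> [_ e1] [_ e2]; apply/funext => i; apply/funext => a; apply/funext => b.
by apply/propext; rewrite e1 e2.
Qed.

(** [up x] is the only direction in which the neighbor of [x] may be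
undetermined. No edge is undetermined at both ends, and the far end of a determined
edge has no undetermined direction except possibly back along this edge; so
all directions but [up x] lead away into branches that [x] determines. *)
Definition arboreal_by V (E : graph V) (up : V -> option dir) :=
  forall d x y, nbr E d x y ->
    (up x = Some d -> up y <> Some (opp d)) /\
    (up x <> Some d -> (forall y', nbr E d x y' -> y' = y) /\
                      (forall d', up y = Some d' -> d' = opp d)).

Definition arboreal V (E : graph V) := exists up, arboreal_by E up.

Lemma arboreal_inj V W (E : graph V) (E' : graph W) f :
  epi f E E' -> injective f -> arboreal E' -> arboreal E.
Proof.
move=> ef fI [up upP]; exists (up \o f) => d x y xy.
have [u1 u2] := upP d _ _ (epi_nbr ef xy); split => // /u2[uniq upy].
by split=> [y' xy'|//]; apply/fI/uniq; exact: epi_nbr xy'.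
Qed.

Lemma arboreal_point (E : graph 'I_1) : arboreal E.
Proof.
by exists (fun=> None) => d x y _; split=> // _; split=> // y' _; rewrite !ord1.
Qed.

(** The cover of a serial graph by an arboreal one. Its vertices are of two
kinds: [inl (a, p)] is a copy of [a] whose parent lies in direction [p], and
[inr (a, e, b)] is a root copy of [a] that prescribes [b] as its neighbor in
direction [e]. All remaining neighbors are given by the fixed choice [nxt]. *)
Section cover.
Variables (V : finType) (E : graph V).
Hypothesis Eserial : serial E.

Let nxt d a : V := sval (cid (Eserial d a)).

Let nxtP d a : nbr E d a (nxt d a).
Proof. exact: svalP (cid (Eserial d a)). Qed.

Definition cover_vertex : finType := ((V * dir) + (V * dir * V))%type.

Let lbl (s : cover_vertex) : V :=
  match s with inl (a, _) => a | inr (a, _, _) => a end.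

Let up (s : cover_vertex) : option dir :=
  match s with inl (_, p) => Some p | inr _ => None end.

(* When [b] is not an [e]-neighbor of [a], the prescription of [inr (a, e, b)]
   is ignored; this avoids a subtype of genuine edges. *)
Let child d (s : cover_vertex) : cover_vertex :=
  match s with
  | inl (a, _) => inl (nxt d a, opp d)
  | inr (a, e, b) => inl (if (d == e) && `[< nbr E e a b >] then b else nxt d a, opp d)
  end.

Let nbrc d s t :=
  up s <> Some d /\ t = child d s \/ up t <> Some (opp d) /\ s = child (opp d) t.

Definition cover_graph : graph cover_vertex := fun i s t => nbrc (i, true) s t.

Let cover_nbr d s t : nbr cover_graph d s t <-> nbrc d s t.
Proof.
case: d => i [] //=; rewrite /nbr /cover_graph /nbrc /= /opp /=.
by split=> -[]; tauto.
Qed.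

Let up_child d s : up (child d s) = Some (opp d).
Proof. by case: s => [[a p]|[[a e] b]]. Qed.

Lemma cover_arboreal : arboreal cover_graph.
Proof.
exists up => d s t /cover_nbr[[us ->]|[ut ->]].
  split=> // _; rewrite up_child; split=> [t' /cover_nbr[[_ //]|[_ st']]|d' [<-] //].
  by case: us; rewrite st' up_child oppK.
by split=> //; rewrite up_child oppK.
Qed.

Let lbl_child d s : nbr E d (lbl s) (lbl (child d s)).
Proof.
case: s => [[a p]|[[a e] b]] /=; first exact: nxtP.
by case: ifP => [/andP[/eqP-> /asboolP]//|_]; exact: nxtP.
Qed.

(** Upwards, a parent of [inl (a, p)] is a root: the root copy of a [p]-neighbor
of [a] that prescribes [a] in the opposite direction. *)
Lemma cover_serial : serial cover_graph.
Proof.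
move=> d s; case: (pselect (up s = Some d)) => us; last first.
  by exists (child d s); apply/cover_nbr; left.
case: s us => [[a p]|//] [->].
exists (inr (nxt d a, opp d, a)); apply/cover_nbr; right; split => //=.
by rewrite eqxx /= oppK asboolT // nbr_opp.
Qed.

(** The prescriptions of the roots are what makes every edge of [E] appear in the
cover; the choice [nxt] alone covers only the edges that it selects. The color
[i0] supplies a direction, so that each vertex has a copy with a parent. *)
Lemma cover_epi (i0 : I) : exists f, epi f cover_graph E.
Proof.
exists lbl; split=> [a|i a b]; first by exists (inl (a, (i0, true))).
split=> [Eab|[s [t [<- <-]]]].
  exists (inr (a, (i, true), b)), (child (i, true) (inr (a, (i, true), b))).
  by split => //=; [rewrite eqxx asboolT|left].
move=> [[_ ->]|[_ ->]]; first exact: (lbl_child (i, true)).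
by have := lbl_child (opp (i, true)) t; rewrite nbr_opp.
Qed.
End cover.

Lemma arboreal_cover (i0 : I) (V : finType) (E : graph V) : serial E ->
  exists (W : finType) (E' : graph W) (f : W -> V),
    [/\ arboreal E', serial E' & epi f E' E].
Proof.
move=> sE; have [f ef] := cover_epi sE i0.
exists (cover_vertex V), (cover_graph sE), f; split => //.
  exact: cover_arboreal.
exact: cover_serial.
Qed.

Lemma finite_compactness (T : finType) (P : nat -> T -> Prop) :
  (forall n t, P n.+1 t -> P n t) -> (forall n, exists t, P n t) ->
  exists t, forall n, P n t.
Proof.
move=> PS Pex; apply: contrapT => /forallNP nP.
have nP' t : {n | ~ P n t} by apply/cid/existsNP/nP.
have Ple k n t : (k <= n)%N -> P n t -> P k t.
  by move=> /subnK<-; elim: (n - k)%N => // l IH /PS.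
have [t] := Pex (\max_t sval (nP' t)).
by move/(Ple _ _ _ (leq_bigmax t)); exact: svalP (nP' t).
Qed.

(** Amalgamation over an arboreal graph. A pair [(b, c)] lying over one vertex
survives in the amalgam when it can be continued in every direction. Only the
direction [up] is an obstacle, since in the others any two neighbors lie over
the same vertex. [chain n b c] asks for [n] steps in direction [up], stopping
early at a vertex without such a direction. *)
Section amalgamation.
Variables (A : Type) (EA : graph A) (up : A -> option dir).
Hypothesis A_up : arboreal_by EA up.

Section chains.
Variables (B C : finType) (EB : graph B) (EC : graph C) (f : B -> A) (g : C -> A).
Hypotheses (sB : serial EB) (sC : serial EC) (fE : epi f EB EA) (gE : epi g EC EA).

Fixpoint chain n b c : Prop :=
  f b = g c /\
  if n is n'.+1 then
    forall d, up (f b) = Some d ->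
      exists b' c', [/\ nbr EB d b b', nbr EC d c c' & chain n' b' c']
  else True.

Lemma chain_eq n b c : chain n b c -> f b = g c.
Proof. by case: n => [|n] []. Qed.

Lemma chainS n b c : chain n.+1 b c -> chain n b c.
Proof.
elim: n b c => [|n IH] b c [fg H]; split => // d /H[b' [c' [bb cc bc]]].
by exists b', c'; split => //; exact: IH.
Qed.

Lemma down_eq d b c b' c' : up (f b) <> Some d -> f b = g c ->
  nbr EB d b b' -> nbr EC d c c' -> f b' = g c'.
Proof.
move=> ub fg bb cc; have [_ /(_ ub)[uniq _]] := A_up (epi_nbr fE bb).
by apply/esym/uniq; rewrite fg; exact: (epi_nbr gE cc).
Qed.

(** The chain of a neighbor away from [up] starts with the step back to the
given pair, or is trivial. *)
Lemma chain_down n d b c b' c' : up (f b) <> Some d -> chain n b c ->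
  nbr EB d b b' -> nbr EC d c c' -> chain n b' c'.
Proof.
move=> ub bc bb cc; have fg' := down_eq ub (chain_eq bc) bb cc.
have [_ /(_ ub)[_ upb]] := A_up (epi_nbr fE bb).
case: n bc => [|n] bc; split => // d' /upb ->.
by exists b, c; rewrite !nbr_opp; split => //; exact: chainS.
Qed.

(** Climb to the top of the chain, lift there, and descend: each downward step
is determined in [A], so it can be matched in [C]. *)
Lemma chain_lift n b : exists c, chain n b c.
Proof.
elim: n b => [|n IH] b.
  by have [c gc] := gE.1 (f b); exists c; split.
case ub : (up (f b)) => [d|]; last first.
  by have [c gc] := gE.1 (f b); exists c; split => // d; rewrite ub.
have [b1 bb1] := sB d b; have [c1 bc1] := IH b1.
have [c cc1] := sC (opp d) c1.
have [/(_ ub) ub1 _] := A_up (epi_nbr fE bb1).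
have b1b : nbr EB (opp d) b1 b by rewrite nbr_opp.
exists c; split; first exact: (down_eq ub1 (chain_eq bc1) b1b cc1).
move=> d'; rewrite ub => -[<-]; exists b1, c1; split => //.
by rewrite -(oppK d) nbr_opp.
Qed.

(** By finiteness of [B] and [C] this is the same as an ascent from [(b, c)] that
is infinite or ends over a vertex without direction [up]. *)
Definition live b c := forall n, chain n b c.

Lemma live_eq b c : live b c -> f b = g c.
Proof. by move=> /(_ 0); exact: chain_eq. Qed.

Lemma live_lift b : exists c, live b c.
Proof.
apply: (@finite_compactness C (fun n c => chain n b c)) => [n c|n].
  exact: chainS.
exact: chain_lift.
Qed.

Lemma live_down d b c b' c' : up (f b) <> Some d -> live b c ->
  nbr EB d b b' -> nbr EC d c c' -> live b' c'.
Proof. by move=> ub bc bb cc n; exact: (chain_down ub (bc n) bb cc). Qed.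

Lemma live_up d b c : up (f b) = Some d -> live b c ->
  exists b' c', [/\ nbr EB d b b', nbr EC d c c' & live b' c'].
Proof.
move=> ub bc; pose P n (p : B * C) :=
  [/\ nbr EB d b p.1, nbr EC d c p.2 & chain n p.1 p.2].
have [n p [? ? /chainS ?] //|n|[b' c'] bc'] := @finite_compactness _ P.
  by have [_ /(_ d ub)[b' [c' ?]]] := bc n.+1; exists (b', c').
exists b', c'; have [bb cc _] := bc' 0.
by split => // n; have [] := bc' n.
Qed.

Lemma live_nbr d b c : live b c ->
  exists b' c', [/\ nbr EB d b b', nbr EC d c c' & live b' c'].
Proof.
move=> bc; case: (pselect (up (f b) = Some d)) => ub; first exact: live_up.
have [b' bb] := sB d b; have [c' cc] := sC d c.
by exists b', c'; split => //; exact: live_down bb cc.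
Qed.

(** One end of the edge has this edge among its determined directions; a live
lift of that end extends along the edge automatically. *)
Lemma live_edge d b b' : nbr EB d b b' ->
  exists c c', [/\ live b c, live b' c' & nbr EC d c c'].
Proof.
move=> bb; case: (pselect (up (f b) = Some d)) => ub; last first.
  have [c bc] := live_lift b; have [c' cc] := sC d c.
  by exists c, c'; split => //; exact: live_down bb cc.
have [/(_ ub) ub' _] := A_up (epi_nbr fE bb).
have [c' bc'] := live_lift b'; have [c cc] := sC (opp d) c'.
have b'b : nbr EB (opp d) b' b by rewrite nbr_opp.
exists c, c'; split => //; first exact: live_down ub' bc' b'b cc.
by rewrite -(oppK d) nbr_opp.
Qed.
End chains.

Lemma chain_sym (B C : finType) (EB : graph B) (EC : graph C) f g n b c :
  chain EB EC f g n b c -> chain EC EB g f n c b.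
Proof.
elim: n b c => [|n IH] b c [fg H]; split => // d.
by rewrite -fg => /H[b' [c' [bb cc bc]]]; exists c', b'; split => //; exact: IH.
Qed.

Lemma live_sym (B C : finType) (EB : graph B) (EC : graph C) f g b c :
  live EB EC f g b c -> live EC EB g f c b.
Proof. by move=> bc n; exact: chain_sym. Qed.

End amalgamation.

(** The amalgam is the subgraph of the fibre product induced on live pairs. *)
Lemma arboreal_amalgam (A : Type) (B C : finType)
    (EA : graph A) (EB : graph B) (EC : graph C) f g :
  arboreal EA -> serial EB -> serial EC -> epi f EB EA -> epi g EC EA ->
  exists (D : finType) (ED : graph D) (p : D -> B) (q : D -> C),
    [/\ serial ED, epi p ED EB, epi q ED EC & f \o p =1 g \o q].
Proof.
move=> [up A_up] sB sC fE gE; pose lv := live up EB EC f g.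
pose D : finType := {x : B * C | `[< lv x.1 x.2 >]}.
have mkD b c : lv b c -> {u : D | sval u = (b, c)}.
  move=> bc; have bc' : `[< lv (b, c).1 (b, c).2 >] by exact/asboolP.
  by exists (exist _ (b, c) bc').
have lvD (u : D) : lv (sval u).1 (sval u).2 by exact/asboolP/(svalP u).
pose ED : graph D := fun i u v =>
  EB i (sval u).1 (sval v).1 /\ EC i (sval u).2 (sval v).2.
have nbrD d u v : nbr ED d u v <->
    nbr EB d (sval u).1 (sval v).1 /\ nbr EC d (sval u).2 (sval v).2.
  by case: d => i [].
exists D, ED, (fun u => (sval u).1), (fun u => (sval u).2); split.
- move=> d u; have [b [c [bb cc /mkD[v vE]]]] := live_nbr A_up sB sC fE gE d (lvD u).
  by exists v; apply/nbrD; rewrite vE.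
- split=> [b|i b b'].
    by have [c /mkD[u uE]] := live_lift A_up sB sC fE gE b; exists u; rewrite uE.
  split=> [bb|[u [v [<- <- []]]] //].
  have [c [c' [/mkD[u uE] /mkD[v vE] cc]]] :=
    live_edge A_up sB sC fE gE (d := (i, true)) bb.
  by exists u, v; rewrite /ED uE vE.
- split=> [c|i c c'].
    have [b /live_sym/mkD[u uE]] := live_lift A_up sC sB gE fE c.
    by exists u; rewrite uE.
  split=> [cc|[u [v [<- <- []]]] //].
  have [b [b' [/live_sym/mkD[u uE] /live_sym/mkD[v vE] bb]]] :=
    live_edge A_up sC sB gE fE (d := (i, true)) cc.
  by exists u, v; rewrite /ED uE vE.
- by move=> u; exact: live_eq (lvD u).
Qed.

End graphs.

(** * The bit metric and limits of back and forth *)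

Local Notation C := cantor_space.
Implicit Types x y z : cantor_space.

(** [agree n] is the closed ball of radius [2 ^- n] for the usual metric. *)
Definition agree (n : nat) x y : Prop := forall j, (j < n)%N -> x j = y j.

Lemma agree_sym n x y : agree n x y -> agree n y x.
Proof. by move=> xy j jn; rewrite xy. Qed.

Lemma agree_trans n x y z : agree n x y -> agree n y z -> agree n x z.
Proof. by move=> xy yz j jn; rewrite xy ?yz. Qed.

Lemma agree_le k n x y : (k <= n)%N -> agree n x y -> agree k x y.
Proof. by move=> kn xy j jk; apply: xy; exact: leq_trans kn. Qed.

Lemma agree_all x y : (forall n, agree n x y) -> x = y.
Proof. by move=> xy; apply/funext => j; exact: (xy j.+1). Qed.

Lemma agree_nbhs n x : nbhs x (agree n x).
Proof.
elim: n => [|n IH]; first by apply: filterS filterT.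
have px : nbhs x [set y | y n = x n].
  have /(_ [set x n]) := @proj_continuous nat (fun=> bool) n x.
  by apply; exact: discrete_set1.
apply: filterS2 px IH => y yn xy j; rewrite ltnS leq_eqVlt => /predU1P[->//|].
exact: xy.
Qed.

Lemma nbhs_agree x (V : set C) : nbhs x V -> exists n, agree n x `<=` V.
Proof.
pose F := filter_from [set: nat] (fun n => agree n x).
have FF : Filter F.
  apply: filter_from_filter; first by exists 0%N.
  move=> i j _ _; exists (maxn i j) => // y xy.
  by split; apply: agree_le xy; rewrite ?leq_maxl ?leq_maxr.
have Fx : F --> x.
  apply/cvg_sup => i A [_ [[B _ <-] Bx BA]].
  exists i.+1 => // y xy; apply: BA => /=.
  by rewrite -(xy i (ltnSn i)).
by move=> /Fx[n _ nV]; exists n.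
Qed.

Lemma continuous_agree (f : C -> C) : continuous f ->
  forall n, exists k, forall x y, agree k x y -> agree n (f x) (f y).
Proof.
move=> cf n.
pose P k x := forall y, agree k x y -> agree n (f x) (f y).
have /compact_near_coveringP cov := cantor_space_compact.
suff : \forall k \near \oo, [set: C] `<=` P k.
  by move=> [k _ kP]; exists k => x y; exact: (kP k (leqnn k) x I y).
apply: cov => x _.
have /nbhs_agree[k kx] := cf x _ (agree_nbhs n (f x)).
exists (agree k x, [set l | (k <= l)%N]); first by split; [exact: agree_nbhs|exists k].
move=> [y l] /= [xy kl] z yz; apply: (@agree_trans _ _ (f x)).
  by apply/agree_sym/kx.
by apply/kx/(agree_trans xy); exact: agree_le yz.
Qed.

Lemma agree_continuous (f : C -> C) :
  (forall n, exists k, forall x y, agree k x y -> agree n (f x) (f y)) ->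
  continuous f.
Proof.
move=> uf x V /nbhs_agree[n nV]; have [k kf] := uf n.
by apply: (filterS _ (agree_nbhs k x)) => y xy; exact/nV/kf.
Qed.

(** A homeomorphism is built as the intersection of a decreasing sequence of
relations, which stand for its finite approximations. [open_rel] says that such
a relation is open, uniformly in the points. *)
Definition open_rel (r : C -> C -> Prop) :=
  exists n, forall x x' y y', agree n x x' -> agree n y y' -> r x y -> r x' y'.

Definition bitotal (r : C -> C -> Prop) :=
  (forall x, exists y, r x y) /\ (forall y, exists x, r x y).

Definition fine_rel n (r : C -> C -> Prop) :=
  (forall x y y', r x y -> r x y' -> agree n y y') /\
  (forall x x' y, r x y -> r x' y -> agree n x x').

Lemma limit_map (r : nat -> C -> C -> Prop) :
  (forall n x y, r n.+1 x y -> r n x y) ->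
  (forall n, open_rel (r n)) -> (forall n, bitotal (r n)) ->
  (forall n, fine_rel n (r n)) ->
  exists2 f : C -> C, continuous f & forall n x, r n x (f x).
Proof.
move=> rS ro rb rf.
have rle k n x y : (k <= n)%N -> r n x y -> r k x y.
  by move=> /subnK<-; elim: (n - k)%N => // l IH /rS.
have [u ru] : {u : nat -> C -> C & forall n x, r n x (u n x)}.
  exists (fun n x => sval (cid ((rb n).1 x))) => n x; exact: svalP (cid _).
(* The [j]-th bit of a partner of [x] no longer changes from stage [j.+1] on. *)
pose f x : C := fun j => u j.+1 x j.
have fu n x : agree n (u n x) (f x).
  move=> j jn; apply: ((rf j.+1).1 x _ (u j.+1 x)) (ltnSn j); last exact: ru.
  exact: rle jn (ru n x).
have rfx n x : r n x (f x).
  have [k kr] := ro n; set l := maxn k n.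
  apply: (kr x x (u l x)) => //.
    by apply: (@agree_le _ l); [exact: leq_maxl|exact: fu].
  by apply: (@rle _ l); [exact: leq_maxr|exact: ru].
exists f => //; apply: agree_continuous => n; have [k kr] := ro n.
exists k => x y xy; apply: (rf n).1 (rfx n y).
exact: (kr x y (f x)).
Qed.

Lemma limit_homeo (r : nat -> C -> C -> Prop) :
  (forall n x y, r n.+1 x y -> r n x y) ->
  (forall n, open_rel (r n)) -> (forall n, bitotal (r n)) ->
  (forall n, fine_rel n (r n)) ->
  exists h : cantor_homeo, forall n x, r n x (homeo_fun h x).
Proof.
move=> rS ro rb rf.
have [f cf rfx] := limit_map rS ro rb rf.
have [||||g cg rgx] := @limit_map (fun n y x => r n x y).
- by move=> n x y; exact: rS.
- by move=> n; have [k kr] := ro n; exists k => x x' y y' xx yy; exact: kr.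
- by move=> n; have [] := rb n.
- by move=> n; have [r1 r2] := rf n; split=> [x y y'|x x' y]; [exact: r2|exact: r1].
have hf : homeomorphism f.
  exists g; split => // x; apply: agree_all => n.
    exact: (rf n).2 (rgx n (f x)) (rfx n x).
  exact: (rf n).1 (rfx n (g x)) (rgx n x).
by exists (mk_homeo hf).
Qed.

(** * Uniform topology and Baire category *)

Lemma homeoK (h : cantor_homeo) x : homeo_fun h^-1 (homeo_fun h x) = x.
Proof. by rewrite -homeo_mulE mulVg. Qed.

Lemma homeoVK (h : cantor_homeo) x : homeo_fun h (homeo_fun h^-1 x) = x.
Proof. by rewrite -homeo_mulE mulgV. Qed.

Lemma homeo_unif (h : cantor_homeo) n :
  exists k, forall x y, agree k x y -> agree n (homeo_fun h x) (homeo_fun h y).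
Proof. exact/continuous_agree/homeo_fun_continuous. Qed.

(** Pointwise closeness near each point, which is continuity of evaluation,
becomes uniform by compactness of the Cantor set. *)
Lemma homeo_agree_nbhs n (h : cantor_homeo) :
  nbhs h [set g : cantor_homeo | forall x, agree n (homeo_fun h x) (homeo_fun g x)].
Proof.
have /compact_near_coveringP cov := cantor_space_compact.
suff : \forall g \near h, [set: C] `<=` (fun x => agree n (homeo_fun h x) (homeo_fun g x)).
  by apply: filterS => g gP x; exact: gP.
apply: (cov _ (nbhs h) (fun (g : cantor_homeo) x =>
  agree n (homeo_fun h x) (homeo_fun g x))) => x _.
have [[P Q] [/= Ph Qx] PQ] := @homeo_eval_continuous (h, x) _
  (agree_nbhs n (homeo_fun h x)).
have [k kh] := homeo_unif h n.
exists (Q `&` agree k x, P) => [|[y g] /= [[Qy xy] Pg]].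
  by split => //; apply: filterI => //; exact: agree_nbhs.
apply: (@agree_trans _ _ (homeo_fun h x)); first by apply/agree_sym/kh.
exact: (PQ (g, y)).
Qed.

Lemma entourage_agree (E : set (C * C)) : entourage E ->
  exists n, forall x y, agree n x y -> E (x, y).
Proof.
move=> entE; pose P k x := forall y, agree k x y -> E (x, y).
have /compact_near_coveringP cov := cantor_space_compact.
suff : \forall k \near \oo, [set: C] `<=` P k.
  by move=> [k _ kP]; exists k => x y; exact: (kP k (leqnn k) x I y).
apply: cov => x _.
pose S := split_ent E; have entS : entourage S by exact: entourage_split_ent.
have [k kx] : exists k, agree k x `<=` [set y | S (x, y) /\ S (y, x)].
  apply: nbhs_agree; apply: filterI.
    exact: (@near_entourage _ id x S entS (@cvg_id _ _)).
  exact: (@near_entourage _ id x _ (entourage_inv entS) (@cvg_id _ _)).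
exists (agree k x, [set l | (k <= l)%N]).
  by split; [exact: agree_nbhs|exists k].
move=> [y l] /= [xy kl] z yz; apply: (entourage_split x) => //.
  by have [] := kx _ xy.
by have [] := kx z (agree_trans xy (agree_le kl yz)).
Qed.

Section power.
Variable m : nat.
Implicit Types h g : power cantor_homeo m.

Definition box n h : set (power cantor_homeo m) :=
  [set g | forall i x, agree n (homeo_fun (h i) x) (homeo_fun (g i) x)].

Lemma box_nbhs n h : nbhs h (box n h).
Proof.
apply: (@filter_forall _ _ _ _ (nbhs_filter h)) => i.
have /(_ _ (homeo_agree_nbhs n (h i))) :=
  @proj_continuous 'I_m (fun=> cantor_homeo) i h.
exact.
Qed.

Lemma nbhs_box h (V : set (power cantor_homeo m)) :
  nbhs h V -> exists n, box n h `<=` V.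
Proof.
pose F := filter_from [set: nat] (fun n => box n h).
have FF : Filter F.
  apply: filter_from_filter; first by exists 0%N.
  move=> i j _ _; exists (maxn i j) => // g hg.
  by split=> k x; apply: agree_le (hg k x); rewrite ?leq_maxl ?leq_maxr.
have Fh : F --> h.
  apply/cvg_sup => i A [_ [[B oB <-] Bx BA]].
  have /homeo_nbhsP[E /entourage_agree[n nE] EB] : nbhs (h i) B.
    exact: open_nbhs_nbhs.
  by exists n => // g hg; apply/BA/EB => x; exact/nE/hg.
by move=> /Fh[n _ nV]; exists n.
Qed.

(** Controlling the inverses as well gives a complete uniformity: with [box]
alone a Cauchy sequence of homeomorphisms may converge to a map that is not
injective. *)
Definition box_inv n h : set (power cantor_homeo m) :=
  [set g | forall i x, agree n (homeo_fun (h i) x) (homeo_fun (g i) x) /\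
    agree n (homeo_fun (h i)^-1 x) (homeo_fun (g i)^-1 x)].

Lemma box_inv_nbhs n h : nbhs h (box_inv n h).
Proof.
apply: (@filter_forall _ _ _ _ (nbhs_filter h)) => i.
have /(_ _ (homeo_agree_nbhs n (h i)^-1)) hV := @homeo_invg_continuous (h i).
have /(_ _ (filterI (homeo_agree_nbhs n (h i)) hV)) :=
  @proj_continuous 'I_m (fun=> cantor_homeo) i h.
apply: (@filterS _ (nbhs h)) => g [/= h1 h2] x.
by split; [exact: h1|exact: h2].
Qed.

(** The usual nested construction; the limit of the centers is a tuple of
homeomorphisms because both the maps and their inverses are controlled. *)
Lemma baire (U : nat -> set (power cantor_homeo m)) :
  (forall k, open (U k)) -> (forall k, dense (U k)) ->
  exists h, forall k, U k h.
Proof.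
move=> oU dU.
pose next k (p q : power cantor_homeo m * nat) :=
  [/\ box_inv q.2 q.1 `<=` U k, box_inv p.2 p.1 q.1, (p.2 <= q.2)%N & (k < q.2)%N].
have step k p : {q | next k p q}.
  apply/cid; case: p => h n.
  have [h' [hh' Uh']] : (box_inv n h)° `&` U k !=set0.
    apply: dU; last exact: open_interior.
    by exists h; exact: box_inv_nbhs.
  have /nbhs_box[l lU] : nbhs h' (U k) by exact: open_nbhs_nbhs.
  exists (h', maxn (maxn n l) k.+1); split => /=.
  - move=> g hg; apply: lU => i x; apply: agree_le (hg i x).1.
    by rewrite -maxnA maxnCA leq_maxl.
  - exact: interior_subset.
  - by rewrite -maxnA leq_maxl.
  - by rewrite leq_maxr.
pose s := fix s k := if k is k'.+1 then sval (step k' (s k')) else ((fun=> 1), 0%N).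
have sP k : next k (s k) (s k.+1) by exact: svalP (step k (s k)).
pose r i k x y := agree (s k).2 (homeo_fun ((s k).1 i) x) y /\
  agree (s k).2 (homeo_fun ((s k).1 i)^-1 y) x.
have [g gr] : {g : power cantor_homeo m & forall i k x, r i k x (homeo_fun (g i) x)}.
  suff H i : {g : cantor_homeo | forall k x, r i k x (homeo_fun g x)}.
    by exists (fun i => sval (H i)) => i; exact: svalP (H i).
  apply/cid/limit_homeo.
  - move=> k x y [r1 r2]; have [_ b le _] := sP k.
    have [b1 _] := b i x; have [_ b2] := b i y; split.
      by apply: agree_trans b1 _; exact: agree_le r1.
    by apply: agree_trans b2 _; exact: agree_le r2.
  - move=> k; have [k1 h1] := homeo_unif ((s k).1 i) (s k).2.
    have [k2 h2] := homeo_unif ((s k).1 i)^-1 (s k).2.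
    exists (maxn (maxn k1 k2) (s k).2) => x x' y y' xx yy [r1 r2].
    have xx2 : agree (s k).2 x x' by apply: agree_le xx; exact: leq_maxr.
    have yy2 : agree (s k).2 y y' by apply: agree_le yy; exact: leq_maxr.
    split.
      apply: agree_trans yy2; apply: agree_trans r1; apply/agree_sym/h1.
      by apply: agree_le xx; rewrite -maxnA leq_maxl.
    apply: agree_trans xx2; apply: agree_trans r2; apply/agree_sym/h2.
    by apply: agree_le yy; rewrite -maxnA maxnCA leq_maxl.
  - move=> k; split=> [x|y].
      by exists (homeo_fun ((s k).1 i) x); split => //; rewrite homeoK.
    by exists (homeo_fun ((s k).1 i)^-1 y); split => //; rewrite homeoVK.
  - move=> k; have kk : (k <= (s k).2)%N by case: (k) => // l; have [] := sP l.
    split=> [x y y' [r1 _] [r2 _]|x x' y [_ r1] [_ r2]];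
      by apply: agree_le kk _; apply: agree_trans r2; exact: agree_sym.
exists g => k; have [bU _ _ _] := sP k; apply: bU => i x; split.
  by have [] := gr i k.+1 x.
by have [_] := gr i k.+1 (homeo_fun (g i)^-1 x); rewrite homeoVK.
Qed.

End power.

(** * Colorings and homogeneity of the Cantor space *)

Definition level V n (c : C -> V) := forall x y, agree n x y -> c x = c y.
Definition separating V n (c : C -> V) := forall x y, c x = c y -> agree n x y.

(** Locally constant maps are given by a level, on which they are constant on
cylinders; compactness makes this no restriction. A coloring onto a finite set
is the same as a labeled clopen partition into nonempty pieces. *)
Definition coloring V (c : C -> V) := (exists n, level n c) /\ onto c.

Lemma separating_le V k n (c : C -> V) : (k <= n)%N -> separating n c -> separating k c.
Proof. by move=> kn nc x y /nc; exact: agree_le. Qed.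

Lemma coloring_comp V W (c : C -> V) (f : V -> W) :
  coloring c -> onto f -> coloring (f \o c).
Proof.
move=> [[n nc] oc] of_; split=> [|w].
  by exists n => x y /nc /= ->.
by have [v <-] := of_ w; have [x <-] := oc v; exists x.
Qed.

Lemma coloring_factor V W n (c : C -> V) (w : C -> W) :
  level n c -> separating n w -> onto w -> exists f, f \o w = c.
Proof.
move=> nc nw ow; exists (fun b => c (sval (cid (ow b)))); apply/funext => x /=.
by case: cid => y /= /nw /nc.
Qed.

Definition first_bits n x : {ffun 'I_n -> bool} := [ffun i : 'I_n => x i].

Lemma first_bits_agree n x y : first_bits n x = first_bits n y <-> agree n x y.
Proof.
split=> [/ffunP xy j jn|xy]; first by have := xy (Ordinal jn); rewrite !ffunE.
by apply/ffunP => i; rewrite !ffunE; exact: xy.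
Qed.

(** Every clopen piece is infinite, so it can be cut into as many clopen pieces as
wished. *)
Lemma coloring_split (V W : finType) (c : C -> V) (f : W -> V) :
  coloring c -> onto f -> exists2 d, coloring d & f \o d = c.
Proof.
move=> [[n nc] oc] of_.
(* The bits following the level of [c] name [b] by a single true bit, at the rank
   of [b]; cylinders whose bits name no suitable element get a default color. *)
pose code b x := [forall b' : W, x (n + enum_rank b')%N == (b' == b)].
pose d x := odflt (sval (cid (of_ (c x)))) [pick b | (f b == c x) && code b x].
have fd : f \o d = c.
  apply/funext => x; rewrite /d /=; case: pickP => [b /andP[/eqP]//|_] /=.
  by case: cid.
exists d => //; split=> [|b].
  exists (n + #|W|)%N => x y xy; rewrite /d.
  have cxy : c x = c y by apply/nc/(agree_le _ xy)/leq_addr.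
  rewrite cxy; congr odflt; apply: eq_pick => b; congr andb.
  by apply: eq_forallb => b'; rewrite xy // ltn_add2l.
have [x cx] := oc (f b).
pose y : C := fun j => if (j < n)%N then x j else j == (n + enum_rank b)%N.
have cy : c y = f b by rewrite -cx; apply: nc => j jn; rewrite /y jn.
have codey b' : code b' y -> b' = b.
  move=> /forallP/(_ b); rewrite /y ltnNge leq_addr /= eqxx.
  by move=> /eqP/esym/eqP.
exists y; rewrite /d cy; case: pickP => [b' /andP[_ /codey]//|/(_ b)].
rewrite eqxx /= => /negP; case; apply/forallP => b'.
by rewrite /y ltnNge leq_addr /= eqn_add2l (inj_eq val_inj) (inj_eq enum_rank_inj).
Qed.

Lemma coloring_refine (V : finType) (c : C -> V) n : coloring c ->
  exists (W : finType) (d : C -> W) (f : W -> V),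
    [/\ coloring d, separating n d, onto f & f \o d = c].
Proof.
move=> [[l lc] oc]; pose p x := (c x, first_bits n x).
pose W : finType := {q : V * {ffun 'I_n -> bool} | `[< exists x, p x = q >]}.
have pW x : `[< exists y, p y = p x >] by apply/asboolP; exists x.
exists W, (fun x => exist _ (p x) (pW x)), (fun q => (sval q).1); split => //.
- split=> [|[q qW]].
    exists (maxn l n) => x y xy; apply/val_inj => /=; congr pair.
      exact/lc/(agree_le _ xy)/leq_maxl.
    exact/first_bits_agree/(agree_le _ xy)/leq_maxr.
  by have [x pxq] := asboolP _ qW; exists x; exact/val_inj.
- by move=> x y [_ /first_bits_agree].
- by move=> a; have [x cx] := oc a; exists (exist _ (p x) (pW x)).
Qed.

(** [M] is a family of approximations; the two extension hypotheses make an
approximation finer on the domain side (forth) and on the codomain side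
(back). *)
Lemma back_and_forth (M : (C -> C -> Prop) -> Prop) (r0 : C -> C -> Prop) :
  M r0 -> (forall r, M r -> open_rel r /\ bitotal r) ->
  (forall r n, M r -> exists r', [/\ M r', forall x y, r' x y -> r x y
     & forall x x' y, r' x y -> r' x' y -> agree n x x']) ->
  (forall r n, M r -> exists r', [/\ M r', forall x y, r' x y -> r x y
     & forall x y y', r' x y -> r' x y' -> agree n y y']) ->
  exists h : cantor_homeo, (forall x, r0 x (homeo_fun h x)) /\
    forall n, exists r, [/\ M r, fine_rel n r & forall x, r x (homeo_fun h x)].
Proof.
move=> M0 Mob forth back.
have step n (p : {r | M r}) : {q : {r | M r} |
    (forall x y, sval q x y -> sval p x y) /\ fine_rel n (sval q)}.
  apply: cid; have [r1 [M1 r1p f1]] := forth _ n (svalP p).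
  have [r2 [M2 r21 f2]] := back _ n M1.
  exists (exist _ r2 M2); split => /= [x y /r21/r1p//|]; split => //.
  by move=> x x' y /r21 xy /r21; exact: f1 xy.
pose s := fix s n := if n is n'.+1 then sval (step n (s n'))
  else sval (step 0%N (exist _ r0 M0)).
have sS n x y : sval (s n.+1) x y -> sval (s n) x y.
  exact: (svalP (step n.+1 (s n))).1.
have sfine n : fine_rel n (sval (s n)).
  by case: n => [|n]; exact: (svalP (step _ _)).2.
have [h hs] := limit_homeo sS (fun n => (Mob _ (svalP (s n))).1)
  (fun n => (Mob _ (svalP (s n))).2) sfine.
exists h; split=> [x|n].
  exact: ((svalP (step 0%N (exist _ r0 M0))).1 x _ (hs 0%N x)).
by exists (sval (s n)); split => //; exact: svalP.
Qed.

Definition same V (u v : C -> V) x y := u x = v y.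

Lemma same_open V (u v : C -> V) :
  coloring u -> coloring v -> open_rel (same u v) /\ bitotal (same u v).
Proof.
move=> [[k ku] ou] [[l lv] ov]; split.
  exists (maxn k l) => x x' y y' xx yy; rewrite /same.
  rewrite (ku x x'); last exact: agree_le (leq_maxl _ _) xx.
  by rewrite (lv y y') //; exact: agree_le (leq_maxr _ _) yy.
split=> [x|y]; first by have [y yx] := ov (u x); exists y.
by have [x xy] := ou (v y); exists x.
Qed.

(** Back and forth between [u] and [v]: refine one of them so that it separates
more points, and cut the pieces of the other one accordingly. *)
Lemma coloring_homogeneous (V : finType) (u v : C -> V) :
  coloring u -> coloring v ->
  exists h : cantor_homeo, forall x, v (homeo_fun h x) = u x.
Proof.
move=> cu cv; pose M r := exists (W : finType) (u' v' : C -> W),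
  [/\ coloring u', coloring v' & r = same u' v'].
have [||r n|r n|h [h0 _]] := @back_and_forth M (same u v).
- by exists V, u, v.
- by move=> r [W [u' [v' [? ? ->]]]]; exact: same_open.
- move=> [W [a [b [ca cb ->]]]].
  have [W' [a' [f [ca' sa' of_ fa]]]] := coloring_refine n ca.
  have [b' cb' fb] := coloring_split cb of_.
  exists (same a' b'); split=> [|x y xy|x x' y xy xy'].
  + by exists W', a', b'.
  + by rewrite /same -fa -fb /= xy.
  + by apply: sa'; rewrite xy xy'.
- move=> [W [a [b [ca cb ->]]]].
  have [W' [b' [f [cb' sb' of_ fb]]]] := coloring_refine n cb.
  have [a' ca' fa] := coloring_split ca of_.
  exists (same a' b'); split=> [|x y xy|x y y' xy xy'].
  + by exists W', a', b'.
  + by rewrite /same -fa -fb /= xy.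
  + by apply: sb'; rewrite -xy -xy'.
- by exists h => x; rewrite -h0.
Qed.

Section patterns.
Variable m : nat.
Implicit Types h g : power cantor_homeo m.

Definition pattern V (c : C -> V) h : graph 'I_m V :=
  fun i a b => exists x, c x = a /\ c (homeo_fun (h i) x) = b.

Lemma pattern_serial V (c : C -> V) h : onto c -> serial (pattern c h).
Proof.
move=> oc [i []] a; have [x <-] := oc a.
  by exists (c (homeo_fun (h i) x)), x.
by exists (c (homeo_fun (h i)^-1 x)), (homeo_fun (h i)^-1 x); rewrite homeoVK.
Qed.

Lemma pattern_epi V W (c : C -> V) (d : C -> W) (f : W -> V) h :
  onto c -> f \o d = c -> epi f (pattern d h) (pattern c h).
Proof.
move=> oc fd; split=> [a|i a b]; first by have [x <-] := oc a; exists (d x); rewrite -fd.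
rewrite -fd; split=> [[x [<- <-]]|[_ [_ [<- <- [x [<- <-]]]]]]; last by exists x.
by exists (d x), (d (homeo_fun (h i) x)); split => //; exists x.
Qed.

Lemma pattern_box V n (c : C -> V) h g :
  level n c -> box n h g -> pattern c g = pattern c h.
Proof.
move=> nc hg; apply/funext => i; apply/funext => a; apply/funext => b.
by apply/propext; split=> -[x [xa <-]]; exists x; split => //;
  rewrite (nc _ _ (hg i x)).
Qed.

(** If [g] and [h] have the same pattern then, for each [x], the image [g x] has
the color of [h x'] for some [x'] of the color of [x]. A fine coloring forces
[x'] near [x], hence [h x'] near [h x]. *)
Lemma box_pattern n h : exists k, forall V (c : C -> V) g,
  separating k c -> pattern c g = pattern c h -> box n h g.
Proof.
have kh i : {k | forall x y, agree k x y ->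
    agree n (homeo_fun (h i) x) (homeo_fun (h i) y)}.
  exact/cid/homeo_unif.
exists (maxn n (\max_i sval (kh i))) => V c g sc gh i x.
have [x' [/sc xx /sc gx]] : pattern c h i (c x) (c (homeo_fun (g i) x)).
  by rewrite -gh; exists x.
apply: (@agree_trans _ _ (homeo_fun (h i) x')).
  apply/agree_sym/(svalP (kh i)); apply: agree_le xx.
  by apply: leq_trans (leq_maxr _ _); exact: (leq_bigmax i).
by apply: agree_le gx; exact: leq_maxl.
Qed.

(** Color each point by the edge along which it is to be moved, once through the
source and once through the target; a homeomorphism exchanging these two
colorings has the prescribed edges. *)
Lemma pattern_realize (V : finType) (c : C -> V) (E : graph 'I_m V) :
  coloring c -> serial E -> exists h, pattern c h = E.
Proof.
move=> cc sE.
suff H i : {g : cantor_homeo | forall a b,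
    E i a b <-> exists x, c x = a /\ c (homeo_fun g x) = b}.
  exists (fun i => sval (H i)).
  apply/funext => i; apply/funext => a; apply/funext => b.
  by have [EP PE] := svalP (H i) a b; apply/propext; split=> [|] ab; [exact: PE|exact: EP].
apply/cid; pose K : finType := {p : V * V | `[< E i p.1 p.2 >]}.
have mkK a b : E i a b -> {k : K | sval k = (a, b)}.
  move=> ab; have ab' : `[< E i (a, b).1 (a, b).2 >] by exact/asboolP.
  by exists (exist _ (a, b) ab').
have src : onto (fun k : K => (sval k).1).
  by move=> a; have [b /mkK[k kE]] := sE (i, true) a; exists k; rewrite kE.
have tgt : onto (fun k : K => (sval k).2).
  by move=> a; have [b /mkK[k kE]] := sE (i, false) a; exists k; rewrite kE.
have [u cu uc] := coloring_split cc src.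
have [v cv vc] := coloring_split cc tgt.
have [g gvu] := coloring_homogeneous cu cv; exists g => a b.
have cg x : c (homeo_fun g x) = (sval (u x)).2 by rewrite -vc /= gvu.
split=> [/mkK[k kE]|[x [<- <-]]].
  by have [x ux] := cu.2 k; exists x; rewrite cg -uc /= ux kE.
by rewrite cg -uc /=; exact/asboolP/(svalP (u x)).
Qed.

End patterns.

(** * Generic tuples *)

Section generic.
Variable m : nat.
Implicit Types h g : power cantor_homeo m.

Definition has_arboreal n : set (power cantor_homeo m) :=
  [set h | exists (N : nat) (c : C -> 'I_N),
    [/\ coloring c, separating n c & arboreal (pattern c h)]].

(** For an arboreal pattern of [h] on [c] this is an extension property: the
abstract refinement [E] of the pattern comes from a refinement of [c]. *)
Definition lift_realized V W (c : C -> V) (f : W -> V) (E : graph 'I_m W) :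
    set (power cantor_homeo m) :=
  [set h | arboreal (pattern c h) -> epi f E (pattern c h) ->
    exists d : C -> W, [/\ coloring d, f \o d = c & pattern d h = E]].

Lemma open_box (U : set (power cantor_homeo m)) :
  (forall h, U h -> exists n, box n h `<=` U) -> open U.
Proof.
move=> UP; rewrite openE => h /UP[n nU].
by apply: (filterS nU); exact: box_nbhs.
Qed.

Lemma dense_box (U : set (power cantor_homeo m)) :
  (forall h n, exists2 g, box n h g & U g) -> dense U.
Proof.
move=> UP O [h Oh] oO; have /nbhs_box[n nO] : nbhs h O by exact: open_nbhs_nbhs.
by have [g hg Ug] := UP h n; exists g; split => //; exact: nO.
Qed.

Lemma open_dense_guard (T : topologicalType) (P : Prop) (U : set T) :
  (P -> open U /\ dense U) ->
  open [set h | P -> U h] /\ dense [set h | P -> U h].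
Proof.
move=> PU; case: (pselect P) => [p|np].
  rewrite [mkset _](_ : _ = U); first exact: PU.
  by apply/seteqP; split=> h //= Uh; exact: Uh.
rewrite [mkset _](_ : _ = setT); last by apply/seteqP; split=> // h _ /np.
by split; [exact: openT|move=> O; rewrite setIT].
Qed.

Lemma has_arboreal_open n : open (has_arboreal n).
Proof.
apply: open_box => h [N [c [cc sc ac]]]; have [[k kc] _] := cc.
by exists k => g /(pattern_box kc) gh; exists N, c; rewrite gh.
Qed.

(** Patterns are locally constant in the tuple, so the hypotheses of the
extension property and its conclusion are both open. *)
Lemma lift_realized_open V W (c : C -> V) (f : W -> V) (E : graph 'I_m W) :
  coloring c -> open (lift_realized c f E).
Proof.
move=> [[k kc] _]; apply: open_box => h hL.
case: (pselect (arboreal (pattern c h) /\ epi f E (pattern c h))) => [[ha he]|nh].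
  have [d [cd fd dE]] := hL ha he; have [[l ld] _] := cd.
  by exists l => g /(pattern_box ld) gh _ _; exists d; rewrite gh.
by exists k => g /(pattern_box kc) gh; rewrite /lift_realized /= gh => ha he; case: nh.
Qed.

Lemma point_coloring : coloring (fun=> ord0 : 'I_1).
Proof. by split=> [|a]; [exists 0%N|exists point; rewrite ord1]. Qed.

Lemma box_coloring h n l : exists (V : finType) (c : C -> V),
  [/\ coloring c, separating l c &
     forall g, pattern c g = pattern c h -> box n h g].
Proof.
have [k kP] := box_pattern n h.
have [V [c [_ [cc sc _ _]]]] := coloring_refine (maxn k l) point_coloring.
exists V, c; split => //; first exact: separating_le (leq_maxr _ _) sc.
by move=> g; apply: kP; exact: separating_le (leq_maxl _ _) sc.
Qed.

(** Cover the pattern of [h] on a fine coloring by an arboreal graph, and realize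
the cover: the new tuple has the same pattern as [h], so it is close to [h]. *)
Lemma has_arboreal_dense n : (0 < m)%N -> dense (has_arboreal n).
Proof.
move=> m0; apply: dense_box => h k.
have [V [c [cc sc cb]]] := box_coloring h k n.
have [W [E [f [aE sE fE]]]] :=
  arboreal_cover (Ordinal m0) (pattern_serial h cc.2).
have [d cd fd] := coloring_split cc fE.1.
have [g gE] := pattern_realize cd sE.
exists g.
  apply: cb; apply: (epi_unique (f := f) (E := E)) => //.
  by rewrite -gE; exact: pattern_epi cc.2 fd.
exists #|W|, (enum_rank \o d); split.
- by apply: coloring_comp => // i; exists (enum_val i); rewrite enum_valK.
- by move=> x y /= /enum_rank_inj xy; apply: sc; rewrite -fd /= xy.
- apply: (@arboreal_inj _ _ _ _ _ enum_val _ enum_val_inj aE).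
  rewrite -gE; apply: pattern_epi; first exact: cd.2.
  by apply/funext => x /=; rewrite enum_rankK.
Qed.

(** A fine coloring [e] gives a second epimorphism onto the arboreal pattern of
[h] on [c]. Realizing an amalgam of the two produces a tuple which has the
pattern of [h] on [e], hence is close to [h], and a refinement with pattern
[E]. *)
Lemma lift_realized_dense (V W : finType) (c : C -> V) (f : W -> V) (E : graph 'I_m W) :
  coloring c -> serial E -> dense (lift_realized c f E).
Proof.
move=> cc sE; apply: dense_box => h k; have [[l lc] oc] := cc.
case: (pselect (arboreal (pattern c h) /\ epi f E (pattern c h))) => [[ha he]|nh]; last first.
  by exists h => // ha he; case: nh.
have [U [e [ce se eb]]] := box_coloring h k l.
have [q qe] := coloring_factor lc se ce.2.
have [D [ED [p1 [p2 [sD e1 e2 p12]]]]] := arboreal_amalgam ha sE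
  (pattern_serial h ce.2) he (pattern_epi h oc qe).
have [d cd p2d] := coloring_split ce e2.1.
have [g gD] := pattern_realize cd sD.
exists g.
  apply: eb; apply: (epi_unique (f := p2) (E := ED)) => //.
  by rewrite -gD; exact: pattern_epi ce.2 p2d.
move=> _ _; exists (p1 \o d).
have cp1d : coloring (p1 \o d) by apply: coloring_comp => //; exact: e1.1.
split => //.
  by apply/funext => x; rewrite /= -qe -p2d /=; exact: p12.
apply: (epi_unique (f := p1) (E := ED)) => //.
by rewrite -gD; apply: pattern_epi => //; exact: cp1d.2.
Qed.

(** Color sets are ordinals so that, up to coding, there are only countably many
conditions. *)
Definition generic : set (power cantor_homeo m) :=
  [set h | (forall n, has_arboreal n h) /\
    forall N M (c : C -> 'I_N) (f : 'I_M -> 'I_N) E,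
      coloring c -> serial E -> lift_realized c f E h].

(** One half of a back and forth step: [h] supplies a fine arboreal pattern, and
the extension property of [g] copies it. *)
Lemma generic_forth h g N (u v : C -> 'I_N) n : generic h -> generic g ->
  coloring u -> coloring v -> arboreal (pattern u h) ->
  pattern u h = pattern v g ->
  exists M (u' v' : C -> 'I_M) (f : 'I_M -> 'I_N),
    [/\ coloring u', coloring v', separating n u', f \o u' = u & f \o v' = v] /\
    arboreal (pattern u' h) /\ pattern u' h = pattern v' g.
Proof.
move=> [hA _] [_ gL] cu cv au uv; have [[l lu] ou] := cu.
have [M [w [cw sw aw]]] := hA (maxn n l).
have [f fw] := coloring_factor lu (separating_le (leq_maxr _ _) sw) cw.2.
have sE := pattern_serial h cw.2.
have fE : epi f (pattern w h) (pattern v g).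
  by rewrite -uv; exact: pattern_epi.
rewrite uv in au.
have [w' [cw' fw' ww']] := gL N M v f _ cv sE au fE.
exists M, w, w', f; split => //; split => //.
exact: separating_le (leq_maxl _ _) sw.
Qed.

(** The approximations are pairs of colorings with equal arboreal patterns. In
the limit the homeomorphism [a] matches the colors of ever finer such pairs, so
[a (h i x)] and [g i (a x)] agree on every bit. *)
Lemma generic_conjugate h g : generic h -> generic g ->
  exists a, diag_conj a h = g.
Proof.
move=> hG gG.
pose M r := exists N (u v : C -> 'I_N), [/\ coloring u, coloring v,
  arboreal (pattern u h), pattern u h = pattern v g & r = same u v].
have [||r n|r n|a [_ aP]] := @back_and_forth M (same (fun=> ord0 : 'I_1) (fun=> ord0)).
- exists 1%N, (fun=> ord0), (fun=> ord0); split => //.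
  + exact: point_coloring.
  + exact: point_coloring.
  + exact: arboreal_point.
- by move=> r [N [u [v [? ? _ _ ->]]]]; exact: same_open.
- move=> [N [u [v [cu cv au uv ->]]]].
  have [K [u' [v' [f [[cu' cv' su fu fv] [au' uv']]]]]] :=
    generic_forth n hG gG cu cv au uv.
  exists (same u' v'); split=> [|x y xy|x x' y xy xy'].
  + by exists K, u', v'.
  + by rewrite /same -fu -fv /= xy.
  + by apply: su; rewrite xy xy'.
- move=> [N [u [v [cu cv au uv ->]]]].
  have av : arboreal (pattern v g) by rewrite -uv.
  have [K [v' [u' [f [[cv' cu' sv fv fu] [av' vu']]]]]] :=
    generic_forth n gG hG cv cu av (esym uv).
  exists (same u' v'); split=> [|x y xy|x y y' xy xy'].
  + by exists K, u', v'; rewrite -vu'.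
  + by rewrite /same -fu -fv /= xy.
  + by apply: sv; rewrite -xy -xy'.
exists a; apply/funext => i; rewrite /diag_conj.
suff ahg : a * h i = g i * a by rewrite ahg mulgK.
apply: homeo_ext => x; rewrite !homeo_mulE; apply: agree_all => n.
have [k kg] := homeo_unif (g i) n.
have [_ [[N [u [v [_ _ _ uv ->]]]] [fr _] auv]] := aP (maxn n k).
have [y [yx hy]] : pattern v g i (u x) (u (homeo_fun (h i) x)).
  by rewrite -uv; exists x.
apply: (@agree_trans _ _ (homeo_fun (g i) y)).
  apply: (agree_le (leq_maxl n k)); apply: fr (auv _) _.
  by rewrite /same hy.
apply: kg; apply: (agree_le (leq_maxr n k)); apply: fr _ (auv x).
by rewrite /same yx.
Qed.

(* Codes for the data [(n, N, M)], [c], [f], [E] of an extension property: a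
   coloring of level [n] is a function of the first [n] bits. *)
Let sigma := ({t : nat * nat * nat & ({ffun {ffun 'I_t.1.1 -> bool} -> 'I_t.1.2} *
  {ffun 'I_t.2 -> 'I_t.1.2} * {ffun 'I_m * 'I_t.2 * 'I_t.2 -> bool})%type}).

Let code_color (s : sigma) : C -> 'I_(tag s).1.2 :=
  fun x => (tagged s).1.1 (first_bits (tag s).1.1 x).
Let code_map (s : sigma) : 'I_(tag s).2 -> 'I_(tag s).1.2 := (tagged s).1.2.
Let code_graph (s : sigma) : graph 'I_m 'I_(tag s).2 :=
  fun i a b => (tagged s).2 (i, a, b).

Let code_set (s : nat + sigma) : set (power cantor_homeo m) :=
  match s with
  | inl n => has_arboreal n
  | inr s => [set h | coloring (@code_color s) /\ serial (@code_graph s) ->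
      lift_realized (@code_color s) (@code_map s) (@code_graph s) h]
  end.

Let basic k : set (power cantor_homeo m) :=
  if unpickle k is Some s then code_set s else setT.

Lemma generic_Gdelta : (0 < m)%N -> Gdelta_dense generic.
Proof.
move=> m0; exists basic.
  move=> k; rewrite /basic; case: unpickle => [[n|s]|] /=.
  - by split; [exact: has_arboreal_open|exact: has_arboreal_dense].
  - apply: open_dense_guard => -[cc sE].
    by split; [exact: lift_realized_open|exact: lift_realized_dense].
  - by split; [exact: openT|move=> O; rewrite setIT].
apply/seteqP; split=> [h [hA hL] k _|h hb].
  rewrite /basic; case: unpickle => [[n|s]|] //=.
  by move=> [cc sE]; exact: hL.
have hcode s : code_set s h by have := hb (pickle s) I; rewrite /basic pickleK.
split=> [n|N M c f E cc sE]; first exact: (hcode (inl n)).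
have [[n nc] _] := cc.
(* Pad a word of length [n] by [false]. *)
pose ext (p : {ffun 'I_n -> bool}) : C := fun j => oapp p false (insub j).
have extE x : agree n (ext (first_bits n x)) x.
  by move=> j jn; rewrite /ext insubT /= ffunE.
pose s : sigma := existT _ (n, N, M) ([ffun p => c (ext p)],
  [ffun a => f a], [ffun p : 'I_m * 'I_M * 'I_M => `[< E p.1.1 p.1.2 p.2 >]]).
have cE : @code_color s = c.
  by apply/funext => x; rewrite /code_color /= ffunE; apply: nc.
have fE : @code_map s = f by apply/funext => x; rewrite /code_map /= ffunE.
have EE : @code_graph s = E.
  apply/funext => i; apply/funext => a; apply/funext => b; apply/propext.
  by rewrite /code_graph /= ffunE /=; split=> /asboolP.
have := hcode (inr s); rewrite /code_set /= -/s.
by rewrite cE fE EE; apply.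
Qed.

End generic.

Theorem theorem1p1 : ample_generics cantor_homeo.
Proof.
move=> m m0; have [U oU gU] := generic_Gdelta m0.
have [h hU] := baire (fun k => (oU k).1) (fun k => (oU k).2).
exists h, (@generic m); first by exists U.
have hG : generic h by rewrite gU => k _; exact: hU.
by move=> g gG; have [a ag] := generic_conjugate hG gG; exists a.
Qed.
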